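(* For $m\in\{3,4\}$ and any edge probability measure $\mu$, \[ 2m\cdot\beta(\mu;C_m)+\beta(\mu;P_{m+1})\le\frac{2}{m^{m-1}}, \] with equality if and only if $\mu$ is the uniform distribution on the edge set of a copy of $C_m$ (in the underlying complete graph).
   Context: $C_k$ is the cycle on $k$ vertices and $P_k$ the path on $k$ vertices. An edge probability measure is a probability measure $\mu$ on the edge set $E(K)$ of some finite complete graph $K$. For a subgraph $H'\subseteq K$, $\mu(H')=\prod_{e\in E(H')}\mu(e)$, and $\beta(\mu;H)=\sum_{H'}\mu(H')$, the sum over all (unlabeled, not necessarily induced) subgraphs $H'$ of $K$ isomorphic to $H$. *)

(* Defs.v *)
From HB Require Import structures.
From mathcomp Require Import all_boot all_order all_algebra.
Set Implicit Arguments. Unset Strict Implicit. Unset Printing Implicit Defensive.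
Import Order.TTheory GRing.Theory Num.Theory.
Local Open Scope ring_scope.

Definition is_edge (n : nat) (e : {set 'I_n}) : bool := #|e| == 2%N.

(* Edge probability measure on E(K_n): nonnegative weights on edges summing
   to 1 (values of mu on non-edges are irrelevant and never used). *)
Definition edge_prob_measure (R : numDomainType) (n : nat)
    (mu : {set 'I_n} -> R) : Prop :=
  (forall e, is_edge e -> 0 <= mu e) /\ \sum_(e | is_edge e) mu e = 1.

Definition cycle_graph (m : nat) : {set {set 'I_m}} :=
  [set e : {set 'I_m} | [exists i : 'I_m, exists j : 'I_m,
     (e == [set i; j]) && (val j == (val i).+1 %% m)%N]].

Definition path_graph (k : nat) : {set {set 'I_k}} :=
  [set e : {set 'I_k} | [exists i : 'I_k, exists j : 'I_k,
     (e == [set i; j]) && (val j == (val i).+1)%N]].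

(* Edge sets of the copies (subgraphs isomorphic to H) of H in K_n, where H
   has vertex set 'I_k and edge set EH (H without isolated vertices, so each
   copy is determined by its edge set). *)
Definition copies (n k : nat) (EH : {set {set 'I_k}}) : {set {set {set 'I_n}}} :=
  [set [set [set f x | x : 'I_k in e] | e : {set 'I_k} in EH]
     | f : {ffun 'I_k -> 'I_n} in [set f : {ffun 'I_k -> 'I_n} | injectiveb f]].

Definition beta (R : numDomainType) (n k : nat) (mu : {set 'I_n} -> R)
    (EH : {set {set 'I_k}}) : R :=
  \sum_(S in copies n EH) \prod_(e in S) mu e.

(* Main.v *)
Require Import Defs.
From HB Require Import structures.
From mathcomp Require Import all_boot all_order all_algebra.
From mathcomp Require Import ring lra zify.
Import Order.TTheory GRing.Theory Num.Theory.
Local Open Scope ring_scope.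

(** Write [W i j] for the weight of the edge [ij], [d i] for the weighted degree
    (so the degrees sum to 2), and [c_k], [p_k] for the sums over labelled
    [k]-cycles and labelled paths on [k] vertices.  Automorphisms give
    [2m beta(C_m) <= c_m] and [2 beta(P_k) <= p_k], so it is enough to bound
    [2 c_m + p_{m+1}].

    m = 3: AM-GM on two edges of each triangle gives
    [2 c_3 + p_4 <= H], where [H] is the sum of [d u * W u x * (d x - W u x)].
    Bounding [d x - W u x] by [1 - d u], respectively [W u x * (d x - W u x)] by
    [d x ^ 2 / 4], yields [H <= sum d^2 (1 - d)] and [H <= sum d^2 (2 - d) / 4].
    A third of the first plus two thirds of the second is
    [4/9 - (sum d (d - 2/3)^2) / 2].

    m = 4: extend a path [a v b t] at either end.  The extending edges are
    distinct and differ from the edges [av], [vb], [bt], [at], hence weigh at most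
    1 minus these four; AM-GM on 4-cycles turns this into
    [2 c_4 + p_5 <= p_4 / 2].  Finally, with [S] the weight between an edge [av]
    and a vertex [b] off it, [2 p_4] is the sum of [W a v * S * (d b - S)], which is at
    most [sum d^2 (1 - d) / 2 <= 1/4].

    In both cases, equality makes the discarded squares vanish, which forces
    all positive weights to equal [1/m] and to lie on an [m]-cycle. *)

(** * Weighted graphs *)

Section WeightedGraph.
Variables (R : realFieldType) (T : finType) (W : T -> T -> R).
Hypothesis Wsym : forall i j, W i j = W j i.
Hypothesis Wdiag : forall i, W i i = 0.
Hypothesis W_ge0 : forall i j, 0 <= W i j.
Hypothesis Wtot : \sum_i \sum_j W i j = 2.

Definition deg i := \sum_j W i j.
Local Notation d := deg.

Definition path4_weight := \sum_a \sum_v \sum_b \sum_t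
  (uniq [:: a; v; b; t])%:R * (W a v * W v b * W b t).
Definition path5_weight := \sum_a \sum_v \sum_b \sum_t \sum_s
  (uniq [:: a; v; b; t; s])%:R * (W a v * W v b * W b t * W t s).
Definition cycle3_weight := \sum_x \sum_y \sum_z W x y * W y z * W z x.
Definition cycle4_weight := \sum_a \sum_v \sum_b \sum_t
  (uniq [:: a; v; b; t])%:R * (W a v * W v b * W b t * W t a).

Lemma deg_ge0 i : 0 <= d i.
Proof. by apply: sumr_ge0. Qed.

Lemma W_le_deg i j : W i j <= d i.
Proof. by rewrite /d (bigD1 j) //= lerDl sumr_ge0. Qed.

Lemma sum_deg : \sum_i d i = 2. Proof. exact: Wtot. Qed.

Lemma sum_col j : \sum_i W i j = d j.
Proof. by apply: eq_bigr => i _. Qed.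

Lemma deg_split a t i : a != t ->
  d i = W i a + W i t + \sum_(j | (j != a) && (j != t)) W i j.
Proof.
by move=> at_; rewrite /d (bigD1 a) //= (bigD1 t) ?addrA //= eq_sym.
Qed.

(** Ordered pairs are sorted by whether they meet [a] or [t]; the edge [at] lies in both degrees and
    is removed once. *)
Lemma total_split a t : a != t ->
  2 * (d a + d t - W a t)
    + \sum_(i | (i != a) && (i != t)) \sum_(j | (j != a) && (j != t)) W i j = 2.
Proof.
move=> at_; rewrite -[RHS]sum_deg [RHS](bigD1 a) //=.
rewrite (bigD1 t (P := fun i => i != a)) 1?eq_sym //=.
rewrite [in RHS](eq_bigr _ (fun i _ => deg_split a t i at_)) !big_split /=.
have Ea : \sum_(i | (i != a) && (i != t)) W i a = d a - W a t.
  rewrite (deg_split a t a at_) Wdiag.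
  rewrite (eq_bigr _ (fun i _ => Wsym i a)); ring.
have Et : \sum_(i | (i != a) && (i != t)) W i t = d t - W a t.
  rewrite (deg_split a t t at_) Wdiag (Wsym a t).
  rewrite (eq_bigr _ (fun i _ => Wsym i t)); ring.
rewrite Ea Et; ring.
Qed.

Lemma deg_pair_le a t : a != t -> d a + d t - W a t <= 1.
Proof.
move=> /total_split E.
have : 0 <= \sum_(i | (i != a) && (i != t))
              \sum_(j | (j != a) && (j != t)) W i j.
  by apply: sumr_ge0 => i _; apply: sumr_ge0.
lra.
Qed.

(** The edge [vb] is disjoint from every edge at [a] or [t]. In the double sum left over by
    [total_split] it occurs as [(v, b)] and as [(b, v)], which matches the factor 2. *)
Lemma deg_pair_edge_le a v b t : uniq [:: a; v; b; t] ->
  d a + d t - W a t + W v b <= 1.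
Proof.
rewrite /= !inE !negb_or => /and4P[/and3P[av ab at_] /andP[vb vt] bt _].
have := total_split a t at_.
rewrite (bigD1 v) ?vt ?andbT 1?eq_sym //= 
  (bigD1 b (P := fun i => (i != a) && (i != t) && (i != v))) /=; last first.
  by rewrite (eq_sym b a) ab bt (eq_sym b v) vb.
have Hv : W v b <= \sum_(j | (j != a) && (j != t)) W v j.
  by rewrite (bigD1 b) /= ?lerDl ?sumr_ge0 // (eq_sym b a) ab bt.
have Hb : W v b <= \sum_(j | (j != a) && (j != t)) W b j.
  rewrite (bigD1 v) /= ?(Wsym b v) ?lerDl ?sumr_ge0 //.
  by rewrite (eq_sym v a) av vt.
set X := \sum_(i | (_ && _ && _) && _) _; have : 0 <= X.
  by apply: sumr_ge0 => i _; apply: sumr_ge0.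
lra.
Qed.

(** * Four-vertex paths and triangles *)

Lemma path4_weightE : path4_weight =
  \sum_a \sum_v \sum_b (b != a)%:R * (W a v * W v b * (d b - W v b - W a b)).
Proof.
apply: eq_bigr => a _; apply: eq_bigr => v _; apply: eq_bigr => b _.
have [->|va] := eqVneq v a.
  by rewrite big1 => [|t _]; rewrite Wdiag !mul0r mulr0.
have [->|bv] := eqVneq b v.
  by rewrite big1 => [|t _]; rewrite Wdiag mulr0 !mul0r mulr0.
have [->|ba] := eqVneq b a.
  rewrite big1 => [|t _]; first by rewrite mul0r.
  by rewrite /= !inE eqxx orbT mul0r.
rewrite mul1r (deg_split v a b va).
rewrite (Wsym b v) (Wsym b a).
rewrite (_ : forall x y z : R, x + y + z - x - y = z); last by move=> *; ring.
rewrite mulr_sumr [RHS]big_mkcond /=; apply: eq_bigr => t _.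
rewrite !inE (eq_sym a v) (eq_sym a b) (eq_sym v b).
rewrite (negbTE va) (negbTE ba) (negbTE bv) (eq_sym a t) (eq_sym v t) /=.
have [->|tb] := eqVneq b t.
  by rewrite Wdiag !mulr0 if_same.
by case: (t == a); case: (t == v); rewrite /= ?mul0r ?mul1r.
Qed.

(** The sum [H]: three-edge walks [a u x y] with [y != u], where [d u] accounts for the first step
    and [a] may coincide with [x] or [y]. *)
Definition walk3 := \sum_u \sum_x d u * (W u x * (d x - W u x)).

Lemma sum3_perm13 (G : T -> T -> T -> R) :
  \sum_a \sum_v \sum_b G a v b = \sum_b \sum_v \sum_a G a v b.
Proof.
rewrite exchange_big [RHS]exchange_big /=; apply: eq_bigr => v _.
exact: exchange_big.
Qed.

(** A walk counted by [walk3] is a path, or closes up to a triangle, or begins by crossing one edge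
    back and forth; the last kind is subtracted. *)
Lemma path4_cycle3 : path4_weight + cycle3_weight
  = walk3 - \sum_u \sum_x W u x ^+ 2 * (d x - W u x).
Proof.
rewrite path4_weightE.
have -> : walk3 = \sum_a \sum_v \sum_b W a v * (W v b * (d b - W v b)).
  rewrite [RHS]exchange_big; apply: eq_bigr => v _ /=.
  rewrite exchange_big; apply: eq_bigr => b _ /=.
  by rewrite -mulr_suml sum_col.
have -> : \sum_u \sum_x W u x ^+ 2 * (d x - W u x) =
    \sum_a \sum_v \sum_b (b == a)%:R * (W a v * (W v b * (d b - W v b))).
  rewrite exchange_big; apply: eq_bigr => a _; apply: eq_bigr => v _ /=.
  rewrite (bigD1 a) //= eqxx big1 ?addr0 => [|b /negbTE->]; last by rewrite mul0r.
  by rewrite (Wsym v a) mul1r; ring.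
rewrite /cycle3_weight -!sumrN -!big_split; apply: eq_bigr => a _ /=.
rewrite -!sumrN -!big_split; apply: eq_bigr => v _ /=.
rewrite -!sumrN -!big_split; apply: eq_bigr => b _ /=.
rewrite (Wsym b a); case: eqVneq => [->|_] /=; last by ring.
by rewrite Wdiag; ring.
Qed.

(* AM-GM on the two edges of a triangle other than [x y]. *)
Lemma cycle3_le : cycle3_weight <= \sum_u \sum_x W u x ^+ 2 * (d x - W u x).
Proof.
have E : \sum_u \sum_x W u x ^+ 2 * (d x - W u x) =
    \sum_u \sum_x \sum_y (y != u)%:R * (W u x ^+ 2 * W x y).
  apply: eq_bigr => u _; apply: eq_bigr => x _.
  rewrite /d (bigD1 u) //= (Wsym x u) [_ + _ - _]addrC addKr mulr_sumr.
  rewrite big_mkcond; apply: eq_bigr => y _.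
  by case: (y == u); rewrite ?mul0r ?mul1r.
(* The same sum with [x] and [y] exchanged, so that adding it to [E] pairs [W u x ^+ 2] with
   [W u y ^+ 2] under the common factor [W x y]. *)
have E' : \sum_u \sum_x W u x ^+ 2 * (d x - W u x) =
    \sum_u \sum_x \sum_y (x != u)%:R * (W u y ^+ 2 * W x y).
  rewrite E; apply: eq_bigr => u _; rewrite exchange_big.
  apply: eq_bigr => x _; apply: eq_bigr => y _.
  by rewrite (Wsym y x).
suff : 2 * cycle3_weight <= \sum_u \sum_x W u x ^+ 2 * (d x - W u x)
    + \sum_u \sum_x W u x ^+ 2 * (d x - W u x) by lra.
rewrite {1}E E' mulr_sumr -big_split; apply: ler_sum => u _ /=.
rewrite mulr_sumr -big_split; apply: ler_sum => x _ /=.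
rewrite mulr_sumr -big_split; apply: ler_sum => y _ /=.
have h := W_ge0 x y; rewrite (Wsym y u).
have [->|yu] := eqVneq y u; first by rewrite Wdiag /=; nra.
have [->|xu] := eqVneq x u; first by rewrite Wdiag /=; nra.
have := mulr_ge0 h (sqr_ge0 (W u x - W u y)).
by rewrite /= !mul1r; nra.
Qed.

Lemma walk3_deg_le : walk3 <= \sum_u d u ^+ 2 * (1 - d u).
Proof.
apply: ler_sum => u _; rewrite expr2 -mulrA -mulr_sumr.
apply: ler_wpM2l; first exact: deg_ge0.
rewrite /d mulr_suml; apply: ler_sum => x _.
have [<-|ux] := eqVneq u x; first by rewrite Wdiag !mul0r.
by apply: ler_wpM2l => //; have := deg_pair_le u x ux; rewrite /d; lra.
Qed.

(** Completes the square in [W u x * (d x - W u x)] around [d x / 2]; the factors [d u] with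
    [u != x] add up to [2 - d x]. *)
Lemma walk3_square : walk3 = \sum_x d x ^+ 2 * (2 - d x) / 4
  - \sum_u \sum_x (x != u)%:R * (d u * (W u x - d x / 2) ^+ 2).
Proof.
have -> : \sum_x d x ^+ 2 * (2 - d x) / 4 =
    \sum_u \sum_x (x != u)%:R * (d u * d x ^+ 2 / 4).
  rewrite exchange_big; apply: eq_bigr => x _ /=.
  rewrite -[in LHS]sum_deg (bigD1 x) //= [d x + _ - _]addrC addKr.
  rewrite mulr_sumr mulr_suml big_mkcond; apply: eq_bigr => u _.
  by rewrite (eq_sym x u); case: (u == x); rewrite /= ?mul0r ?mul1r //; field.
rewrite -sumrN -big_split; apply: eq_bigr => u _ /=.
rewrite -sumrN -big_split; apply: eq_bigr => x _ /=.
have [->|_] := eqVneq x u; first by rewrite Wdiag /=; ring.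
by rewrite /=; field.
Qed.

Lemma cycle3_path4_defect : 2 * cycle3_weight + path4_weight <= 4 / 9
  - (\sum_u d u * (d u - 2 / 3) ^+ 2) / 2
  - 2 / 3 * \sum_u \sum_x (x != u)%:R * (d u * (W u x - d x / 2) ^+ 2).
Proof.
have h1 := path4_cycle3; have h2 := cycle3_le; have h3 := walk3_deg_le.
have h4 := walk3_square.
(* The bound [h3] plus twice [h4], that is, three times the weighted average. The square is centred
   at 2/3, the vertex degree in the uniform triangle. *)
have : \sum_u d u ^+ 2 * (1 - d u) + 2 * \sum_x d x ^+ 2 * (2 - d x) / 4
    = 2 / 3 * 2 - 3 / 2 * \sum_u d u * (d u - 2 / 3) ^+ 2.
  rewrite -[X in _ = _ * X - _]sum_deg !mulr_sumr -sumrN -!big_split /=.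
  by apply: eq_bigr => u _; field.
lra.
Qed.

(** * Four-vertex paths and their extensions *)

Lemma path4_square : 2 * path4_weight = \sum_b d b ^+ 2 * (1 - d b) / 2
  - \sum_a \sum_v \sum_b
      ((b != a) && (b != v))%:R * (W a v * (W a b + W v b - d b / 2) ^+ 2).
Proof.
have -> : \sum_b d b ^+ 2 * (1 - d b) / 2 =
    \sum_a \sum_v \sum_b
      ((b != a) && (b != v))%:R * (W a v * d b ^+ 2 / 4).
  rewrite sum3_perm13; apply: eq_bigr => b _.
  (* The ordered pairs avoiding [b]: from the total 2, both the row and the column of [b] are
     removed. *)
  have E : \sum_(a | a != b) \sum_(v | v != b) W a v = 2 - 2 * d b.
    have Db : \sum_(a | a != b) W a b = d b.
      by rewrite -(sum_col b) [RHS](bigD1 b) //= Wdiag add0r.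
    have := sum_deg; rewrite (bigD1 b) //=.
    rewrite (eq_bigr (fun a => W a b + \sum_(v | v != b) W a v)); last first.
      by move=> a _; rewrite /d (bigD1 b).
    rewrite big_split /= Db; lra.
  have -> : d b ^+ 2 * (1 - d b) / 2 = (2 - 2 * d b) * (d b ^+ 2 / 4) by field.
  rewrite -E mulr_suml big_mkcond; apply: eq_bigr => a _.
  rewrite (eq_sym b a); case: (a == b) => /=.
    by rewrite big1 // => v _; rewrite andbF mul0r.
  rewrite mulr_suml big_mkcond; apply: eq_bigr => v _.
  by rewrite (Wsym v a) (eq_sym b v); case: (v == b); rewrite /= ?mul0r ?mul1r ?mulrA.
rewrite mulr_natl mulr2n {1}path4_weightE path4_weightE.
(* The second copy has [a] and [v] exchanged, so the two summands combine to [W a v * S * (d b - S)]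
   with [S = W a b + W v b], and the square is completed at [d b / 2]. *)
rewrite [X in _ + X]exchange_big -big_split -sumrN -big_split.
apply: eq_bigr => a _ /=.
rewrite -big_split -sumrN -big_split; apply: eq_bigr => v _ /=.
rewrite -big_split -sumrN -big_split; apply: eq_bigr => b _ /=.
rewrite (Wsym v a).
have Wa : b = a -> W a b = 0 by move=> ->.
have Wv : b = v -> W v b = 0 by move=> ->.
by case: (eqVneq b a) => [/Wa ->|_]; case: (eqVneq b v) => [/Wv ->|_] /=; field.
Qed.

(** The chord [at] is removed from both degrees, while [deg_pair_edge_le] gives it back once, so it
    ends up with coefficient one like the path edges. *)
Lemma path4_extension_le a v b t : uniq [:: a; v; b; t] ->
  \sum_(s | s \notin [:: a; v; b; t]) W a s
    + \sum_(s | s \notin [:: a; v; b; t]) W t s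
  <= 1 - W a v - W v b - W b t - W a t.
Proof.
move=> u4; have := deg_pair_edge_le a v b t u4; move: u4.
rewrite /= !inE !negb_or => /and4P[/and3P[av ab at_] /andP[vb vt] bt _].
have Ha : \sum_(s | s \notin [:: a; v; b; t]) W a s <= d a - W a v - W a t.
  rewrite (deg_split v t a vt).
  rewrite (_ : forall x y z : R, x + y + z - x - y = z); last by move=> *; ring.
  rewrite big_mkcond [leRHS]big_mkcond; apply: ler_sum => s _ /=.
  by rewrite !inE !negb_or; case: (s == a); case: (s == v); case: (s == b);
     case: (s == t) => /=.
have Ht : \sum_(s | s \notin [:: a; v; b; t]) W t s <= d t - W b t - W a t.
  rewrite (deg_split b a t) 1?eq_sym // (Wsym t b) (Wsym t a).
  rewrite (_ : forall x y z : R, x + y + z - x - y = z); last by move=> *; ring.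
  rewrite big_mkcond [leRHS]big_mkcond; apply: ler_sum => s _ /=.
  by rewrite !inE !negb_or; case: (s == a); case: (s == v); case: (s == b);
     case: (s == t) => /=.
lra.
Qed.

(** * Comparing 4-cycles with four-vertex paths *)

Lemma sum4_perm12 (G : T -> T -> T -> T -> R) :
  \sum_a \sum_v \sum_b \sum_t G a v b t = \sum_a \sum_v \sum_b \sum_t G v a b t.
Proof. exact: exchange_big. Qed.

Lemma sum4_perm23 (G : T -> T -> T -> T -> R) :
  \sum_a \sum_v \sum_b \sum_t G a v b t = \sum_a \sum_v \sum_b \sum_t G a b v t.
Proof. by apply: eq_bigr => a _; exact: exchange_big. Qed.

Lemma sum4_perm34 (G : T -> T -> T -> T -> R) :
  \sum_a \sum_v \sum_b \sum_t G a v b t = \sum_a \sum_v \sum_b \sum_t G a v t b.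
Proof. by apply: eq_bigr => a _; apply: eq_bigr => v _; exact: exchange_big. Qed.

Lemma sum4_perm13 (G : T -> T -> T -> T -> R) :
  \sum_a \sum_v \sum_b \sum_t G a v b t = \sum_a \sum_v \sum_b \sum_t G b v a t.
Proof. by rewrite sum4_perm12 sum4_perm23 sum4_perm12. Qed.

Lemma sum4_perm24 (G : T -> T -> T -> T -> R) :
  \sum_a \sum_v \sum_b \sum_t G a v b t = \sum_a \sum_v \sum_b \sum_t G a t b v.
Proof. by rewrite sum4_perm23 sum4_perm34 sum4_perm23. Qed.

Lemma uniq4_perm12 (a v b t : T) : uniq [:: v; a; b; t] = uniq [:: a; v; b; t].
Proof.
rewrite /= !inE (eq_sym v a).
by do !case: (_ == _).
Qed.

Lemma uniq4_perm23 (a v b t : T) : uniq [:: a; b; v; t] = uniq [:: a; v; b; t].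
Proof.
rewrite /= !inE (eq_sym b v).
by do !case: (_ == _).
Qed.

Lemma uniq4_perm34 (a v b t : T) : uniq [:: a; v; t; b] = uniq [:: a; v; b; t].
Proof.
rewrite /= !inE (eq_sym t b).
by do !case: (_ == _).
Qed.

(** Intended for [G] a relabelling of [F]: the totals agree, so a pointwise AM-GM against [F + G]
    bounds the cycle weight by a single total. *)
Lemma sum4_amgm (F G : T -> T -> T -> T -> R) :
  \sum_a \sum_v \sum_b \sum_t F a v b t
    = \sum_a \sum_v \sum_b \sum_t G a v b t ->
  (forall a v b t, uniq [:: a; v; b; t] ->
     2 * (W a v * W v b * W b t * W t a) <= F a v b t + G a v b t) ->
  (forall a v b t, ~~ uniq [:: a; v; b; t] -> 0 <= F a v b t + G a v b t) ->
  cycle4_weight <= \sum_a \sum_v \sum_b \sum_t F a v b t.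
Proof.
move=> E le_u ge0.
suff : 2 * cycle4_weight <= \sum_a \sum_v \sum_b \sum_t F a v b t
  + \sum_a \sum_v \sum_b \sum_t F a v b t by lra.
rewrite [X in _ <= _ + X]E mulr_sumr -big_split; apply: ler_sum => a _ /=.
rewrite mulr_sumr -big_split; apply: ler_sum => v _ /=.
rewrite mulr_sumr -big_split; apply: ler_sum => b _ /=.
rewrite mulr_sumr -big_split; apply: ler_sum => t _ /=.
have := le_u a v b t; have := ge0 a v b t.
rewrite /=; case: (_ && _) => /= [_ /(_ isT)|/(_ isT) + _]; first by rewrite mul1r.
by rewrite mul0r mulr0.
Qed.

Definition path4_term a v b t : R :=
  (uniq [:: a; v; b; t])%:R * (W a v * W v b * W b t).

Lemma path4_term_ge0 a v b t : 0 <= path4_term a v b t.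
Proof. by rewrite /path4_term !mulr_ge0. Qed.

(** AM-GM on the opposite edges [vb] and [at], with the other two edges as common factor; [v a t b]
    is the path of the same cycle having [at] in the middle. *)
Lemma cycle4_le_mid :
  cycle4_weight <= \sum_a \sum_v \sum_b \sum_t path4_term a v b t * W v b.
Proof.
apply: (sum4_amgm _ (fun a v b t => path4_term v a t b * W a t)).
- by rewrite sum4_perm12 sum4_perm34.
- move=> a v b t u4.
  rewrite /path4_term (uniq4_perm12 a v t b) (uniq4_perm34 a v b t) u4 !mul1r.
  rewrite (Wsym v a) (Wsym t b) (Wsym t a).
  have := mulr_ge0 (mulr_ge0 (W_ge0 a v) (W_ge0 b t)) (sqr_ge0 (W v b - W a t)).
  nra.
- by move=> a v b t _; rewrite addr_ge0 // mulr_ge0 // path4_term_ge0.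
Qed.

(** AM-GM on the edges [av] and [at], which meet at [a]. *)
Lemma cycle4_le_left :
  cycle4_weight <= \sum_a \sum_v \sum_b \sum_t path4_term a v b t * W a v.
Proof.
apply: (sum4_amgm _ (fun a v b t => path4_term a t b v * W a t)).
- by rewrite sum4_perm24.
- move=> a v b t u4.
  rewrite /path4_term (uniq4_perm23 a b t v) (uniq4_perm34 a b v t) (uniq4_perm23 a v b t).
  rewrite u4 !mul1r.
  rewrite (Wsym t b) (Wsym b v) (Wsym t a).
  have := mulr_ge0 (mulr_ge0 (W_ge0 v b) (W_ge0 b t)) (sqr_ge0 (W a v - W a t)).
  nra.
- by move=> a v b t _; rewrite addr_ge0 // mulr_ge0 // path4_term_ge0.
Qed.

(** AM-GM on the edges [bt] and [at], which meet at [t]. *)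
Lemma cycle4_le_right :
  cycle4_weight <= \sum_a \sum_v \sum_b \sum_t path4_term a v b t * W b t.
Proof.
apply: (sum4_amgm _ (fun a v b t => path4_term b v a t * W a t)).
- by rewrite sum4_perm13.
- move=> a v b t u4.
  rewrite /path4_term (uniq4_perm12 v b a t) (uniq4_perm23 v a b t) (uniq4_perm12 a v b t).
  rewrite u4 !mul1r.
  rewrite (Wsym b v) (Wsym v a) (Wsym t a).
  have := mulr_ge0 (mulr_ge0 (W_ge0 a v) (W_ge0 v b)) (sqr_ge0 (W b t - W a t)).
  nra.
- by move=> a v b t _; rewrite addr_ge0 // mulr_ge0 // path4_term_ge0.
Qed.

Lemma path5_weightE : path5_weight = \sum_a \sum_v \sum_b \sum_t
  path4_term a v b t * \sum_(s | s \notin [:: a; v; b; t]) W t s.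
Proof.
apply: eq_bigr => a _; apply: eq_bigr => v _.
apply: eq_bigr => b _; apply: eq_bigr => t _.
rewrite /path4_term mulr_sumr [RHS]big_mkcond; apply: eq_bigr => s _.
rewrite -[[:: a; v; b; t; s]]/(rcons [:: a; v; b; t] s) rcons_uniq.
by case: (s \notin _); rewrite /= ?mul0r // !mulrA.
Qed.

Lemma path5_weightE_rev : path5_weight = \sum_a \sum_v \sum_b \sum_t
  path4_term a v b t * \sum_(s | s \notin [:: a; v; b; t]) W a s.
Proof.
(* These four transpositions compose to the reversal of [a v b t]. *)
rewrite path5_weightE sum4_perm13 sum4_perm24 sum4_perm12 sum4_perm34.
apply: eq_bigr => a _; apply: eq_bigr => v _.
apply: eq_bigr => b _; apply: eq_bigr => t _.
have -> : path4_term t b v a = path4_term a v b t.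
  rewrite /path4_term -[[:: t; b; v; a]]/(rev [:: a; v; b; t]) rev_uniq.
  by rewrite (Wsym t b) (Wsym b v) (Wsym v a); ring.
congr (_ * _); apply: eq_bigl => s.
by rewrite -[[:: t; b; v; a]]/(rev [:: a; v; b; t]) mem_rev.
Qed.

Lemma path5_cycle4_le : path5_weight + 2 * cycle4_weight <= path4_weight / 2.
Proof.
have h1 := cycle4_le_mid; have h2 := cycle4_le_left; have h3 := cycle4_le_right.
have h4 : cycle4_weight = \sum_a \sum_v \sum_b \sum_t path4_term a v b t * W a t.
  apply: eq_bigr => a _; apply: eq_bigr => v _.
  apply: eq_bigr => b _; apply: eq_bigr => t _.
  by rewrite /path4_term (Wsym t a) !mulrA.
(* The two copies of [path5_weight] stand for extensions at either end. Of the four edge sums, the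
   one with [W a t] equals [cycle4_weight] and the others dominate it. *)
suff : path5_weight + path5_weight
   + \sum_a \sum_v \sum_b \sum_t path4_term a v b t * W a t
   + \sum_a \sum_v \sum_b \sum_t path4_term a v b t * W v b
   + \sum_a \sum_v \sum_b \sum_t path4_term a v b t * W a v
   + \sum_a \sum_v \sum_b \sum_t path4_term a v b t * W b t <= path4_weight by lra.
rewrite {1}path5_weightE path5_weightE_rev.
rewrite -!big_split; apply: ler_sum => a _ /=.
rewrite -!big_split; apply: ler_sum => v _ /=.
rewrite -!big_split; apply: ler_sum => b _ /=.
rewrite -!big_split; apply: ler_sum => t _ /=.
rewrite -!mulrDr -[leRHS]mulr1 -/(path4_term a v b t).
have [u4|u4] := boolP (uniq [:: a; v; b; t]); last first.
  by rewrite /path4_term (negbTE u4) !mul0r.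
apply: ler_wpM2l; first exact: path4_term_ge0.
have := path4_extension_le a v b t u4; lra.
Qed.

Lemma cycle4_path5_defect : 2 * cycle4_weight + path5_weight <= 1 / 16
  - (\sum_u d u * (d u - 1 / 2) ^+ 2) / 8
  - (\sum_a \sum_v \sum_b
      ((b != a) && (b != v))%:R * (W a v * (W a b + W v b - d b / 2) ^+ 2)) / 4.
Proof.
have h1 := path5_cycle4_le; have h2 := path4_square.
(* A termwise identity, summed with total degree 2; 1/2 is the vertex degree in the uniform
   4-cycle. *)
have : \sum_b d b ^+ 2 * (1 - d b) / 2
    = 1 / 8 * 2 - 1 / 2 * \sum_u d u * (d u - 1 / 2) ^+ 2.
  rewrite -[X in _ = _ * X - _]sum_deg !mulr_sumr -sumrN -!big_split /=.
  by apply: eq_bigr => u _; field.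
lra.
Qed.

(** * Sharp bounds and their equality cases *)

Lemma exists_deg_neq0 : exists u, d u != 0.
Proof.
apply/existsP; apply: contraT; rewrite negb_exists => /forallP h.
have := sum_deg; rewrite big1 => [|u _]; first by lra.
by have := h u; rewrite negbK => /eqP.
Qed.

Lemma deg_gap_eq0 (c : R) : \sum_u d u * (d u - c) ^+ 2 = 0 ->
  forall u, d u != 0 -> d u = c.
Proof.
move=> E u u0; have h i : true -> 0 <= d i * (d i - c) ^+ 2.
  by rewrite mulr_ge0 ?sqr_ge0 ?deg_ge0.
have /eqP := psumr_eq0P h E (i := u) isT.
by rewrite mulf_eq0 (negbTE u0) expf_eq0 /= subr_eq0 => /eqP.
Qed.

Lemma masked_square_ge0 (c : bool) (x y : R) : 0 <= x -> 0 <= c%:R * (x * y ^+ 2).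
Proof. by move=> x0; apply: mulr_ge0 => //; rewrite mulr_ge0 ?sqr_ge0. Qed.

Lemma cycle3_path4_le : 2 * cycle3_weight + path4_weight <= 4 / 9.
Proof.
have := cycle3_path4_defect; set A := \sum_u d u * _; set B := \sum_u \sum_x _.
have A_ge0 : 0 <= A.
  by apply: sumr_ge0 => u _; rewrite mulr_ge0 ?sqr_ge0 ?deg_ge0.
have B_ge0 : 0 <= B.
  apply: sumr_ge0 => u _; apply: sumr_ge0 => x _.
  by rewrite masked_square_ge0 ?deg_ge0.
lra.
Qed.

Lemma cycle4_path5_le : 2 * cycle4_weight + path5_weight <= 1 / 16.
Proof.
have := cycle4_path5_defect; set A := \sum_u d u * _; set B := \sum_a \sum_v _.
have A_ge0 : 0 <= A.
  by apply: sumr_ge0 => u _; rewrite mulr_ge0 ?sqr_ge0 ?deg_ge0.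
have B_ge0 : 0 <= B.
  apply: sumr_ge0 => a _; apply: sumr_ge0 => v _; apply: sumr_ge0 => b _.
  by rewrite masked_square_ge0.
lra.
Qed.

(** Degrees are 0 or 2/3, and [W u x = d x / 2] as soon as [d u != 0]. Hence any two vertices of
    positive degree are joined with weight 1/3, and it remains to find three of them. *)
Lemma cycle3_path4_eq : 2 * cycle3_weight + path4_weight = 4 / 9 ->
  exists x y z, [/\ uniq [:: x; y; z], W x y = 1 / 3, W y z = 1 / 3
                    & W z x = 1 / 3].
Proof.
have := cycle3_path4_defect; set A := \sum_u d u * _; set B := \sum_u \sum_x _.
move=> le_b eq_b.
have A_ge0 : 0 <= A.
  by apply: sumr_ge0 => u _; rewrite mulr_ge0 ?sqr_ge0 ?deg_ge0.
have B_ge0' u : true -> 0 <= \sum_x (x != u)%:R * (d u * (W u x - d x / 2) ^+ 2).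
  by move=> _; apply: sumr_ge0 => x _; rewrite masked_square_ge0 ?deg_ge0.
have B_ge0 : 0 <= B by apply: sumr_ge0.
have A0 : A = 0 by lra.
have B0 : B = 0 by lra.
have deg_eq := deg_gap_eq0 _ A0.
have W_eq u x : d u != 0 -> x != u -> W u x = d x / 2.
  move=> u0 xu; have h y : true -> 0 <= (y != u)%:R * (d u * (W u y - d y / 2) ^+ 2).
    by rewrite masked_square_ge0 ?deg_ge0.
  have /eqP := psumr_eq0P h (psumr_eq0P B_ge0' B0 (i := u) isT) (i := x) isT.
  by rewrite xu mul1r mulf_eq0 (negbTE u0) expf_eq0 /= subr_eq0 => /eqP.
(* If the edge to [x] does not exhaust the degree of [u], another neighbour exists. Taking [x] equal
   to [u] yields a first neighbour. *)
have next x u : d u != 0 -> W u x != d u ->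
    exists y, [&& y != u, y != x & d y != 0].
  move=> u0 neq; apply/existsP; apply: contraNT neq; rewrite negb_exists.
  move=> /forallP h; rewrite /d (bigD1 x) //= big1 ?addr0 // => y yx.
  apply/eqP; rewrite eq_le W_ge0 andbT (Wsym u y).
  have [->|yu] := eqVneq y u; first by rewrite Wdiag.
  have := h y; rewrite yu yx /= negbK => /eqP <-; exact: W_le_deg.
have [x x0] := exists_deg_neq0.
have [|y /and3P[yx _ y0]] := next x x x0; first by rewrite Wdiag eq_sym.
have Wxy := W_eq x y x0 yx.
have [|z /and3P[zx zy z0]] := next y x x0.
  by rewrite Wxy (deg_eq y) // (deg_eq x) //; apply/eqP; lra.
exists x, y, z; split.
- by rewrite /= !inE !(eq_sym x) negb_or yx zx eq_sym zy.
- by rewrite Wxy (deg_eq y) //; field.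
- by rewrite W_eq // (deg_eq z) //; field.
- have xz : x != z by rewrite eq_sym.
  by rewrite (W_eq z x z0 xz) (deg_eq x x0); field.
Qed.

Lemma cycle4_path5_eq : 2 * cycle4_weight + path5_weight = 1 / 16 ->
  exists a v b t, [/\ uniq [:: a; v; b; t],
    W a v = 1 / 4, W v b = 1 / 4, W b t = 1 / 4 & W t a = 1 / 4].
Proof.
have := cycle4_path5_defect; set A := \sum_u d u * _; set B := \sum_a \sum_v _.
move=> le_b eq_b.
have A_ge0 : 0 <= A.
  by apply: sumr_ge0 => u _; rewrite mulr_ge0 ?sqr_ge0 ?deg_ge0.
have h3 a v b : true -> 0 <= ((b != a) && (b != v))%:R
    * (W a v * (W a b + W v b - d b / 2) ^+ 2).
  by rewrite masked_square_ge0.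
have h2 a v : true -> 0 <= \sum_b ((b != a) && (b != v))%:R
    * (W a v * (W a b + W v b - d b / 2) ^+ 2).
  by move=> _; apply: sumr_ge0 => b _; exact: h3.
have h1 a : true -> 0 <= \sum_v \sum_b ((b != a) && (b != v))%:R
    * (W a v * (W a b + W v b - d b / 2) ^+ 2).
  by move=> _; apply: sumr_ge0 => v _; exact: h2.
have B_ge0 : 0 <= B by apply: sumr_ge0 => a _; exact: h1.
have A0 : A = 0 by lra.
have B0 : B = 0 by lra.
have deg_eq := deg_gap_eq0 _ A0.
have S_eq a v b : W a v != 0 -> b != a -> b != v -> W a b + W v b = d b / 2.
  move=> W0 ba bv.
  have /eqP := psumr_eq0P (h3 a v)
    (psumr_eq0P (h2 a) (psumr_eq0P h1 B0 (i := a) isT) (i := v) isT) (i := b) isT.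
  by rewrite ba bv mul1r mulf_eq0 (negbTE W0) expf_eq0 /= subr_eq0 => /eqP.
have W_deg u x : W u x != 0 -> d u = 1 / 2.
  move=> ux0; apply: deg_eq; apply: contraNN ux0 => /eqP u0.
  by rewrite eq_le W_ge0 andbT -u0 W_le_deg.
have W_neq u x : W u x != 0 -> x != u.
  by apply: contraNN => /eqP->; rewrite Wdiag.
(* Summing [S_eq] over all [b] off the edge, with [d a = d v = 1/2], gives
   [1 - 2 * W a v = (2 - 1) / 2]. *)
have W_eq a v : W a v != 0 -> W a v = 1 / 4.
  move=> W0; have va := W_neq a v W0.
  have E : \sum_(b | (b != a) && (b != v)) (W a b + W v b)
         = \sum_(b | (b != a) && (b != v)) d b / 2.
    by apply: eq_bigr => b /andP[ba bv]; apply: S_eq.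
  move: E; rewrite big_split -mulr_suml /=.
  have := sum_deg; rewrite (bigD1 a) //= (bigD1 v) //=.
  have := deg_split a v a; rewrite eq_sym => /(_ va); rewrite Wdiag (W_deg a v) //.
  have := deg_split a v v; rewrite eq_sym => /(_ va); rewrite Wdiag (Wsym v a).
  rewrite (W_deg v a) 1?Wsym //; lra.
have next u x : d u != 0 -> W u x != d u -> exists y, (y != x) && (W u y != 0).
  move=> u0 neq; apply/existsP; apply: contraNT neq; rewrite negb_exists.
  move=> /forallP h; rewrite /d (bigD1 x) //= big1 ?addr0 // => y yx.
  by have := h y; rewrite yx /= negbK => /eqP.
have [a a0] := exists_deg_neq0.
have [|v /andP[va av0]] := next a a a0; first by rewrite Wdiag eq_sym.
have av := W_eq a v av0.
have va0 : W v a != 0 by rewrite Wsym.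
have [||b /andP[ba vb0]] := next v a; rewrite ?(W_deg v a) ?(Wsym v a) ?av //;
  try by apply/eqP; lra.
have [||t /andP[tv at0]] := next a v; rewrite ?(W_deg a v) ?av //;
  try by apply/eqP; lra.
have vb := W_eq v b vb0; have at_ := W_eq a t at0.
have bv := W_neq v b vb0; have ta := W_neq a t at0.
(* The edge [vb] already supplies the whole share [d b / 2 = 1/4] that [b] gets from the edge [av],
   so nothing is left for [ab]. The same argument removes [vt], and then the edge [vb] seen from [t]
   leaves 1/4 for [bt]. *)
have ab : W a b = 0.
  have := S_eq a v b av0 ba bv; rewrite vb (W_deg b v) 1?Wsym //; lra.
have tb : t != b by apply: contraNneq at0 => ->; rewrite ab.
have vt : W v t = 0.
  have := S_eq a v t av0 ta tv; rewrite at_ (W_deg t a) 1?Wsym //; lra.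
have bt : W b t = 1 / 4.
  have := S_eq v b t vb0 tv tb; rewrite vt (W_deg t a) 1?Wsym //; lra.
exists a, v, b, t; split; rewrite // 1?Wsym //.
rewrite /= !inE !negb_or (eq_sym a v) (eq_sym a b) (eq_sym a t).
by rewrite (eq_sym v b) (eq_sym v t) (eq_sym b t) va ba ta bv tv tb.
Qed.

End WeightedGraph.

(** * Copies and embeddings *)

Definition copy_of (n k : nat) (EH : {set {set 'I_k}}) (f : {ffun 'I_k -> 'I_n}) :
  {set {set 'I_n}} := [set [set f x | x in e] | e : {set 'I_k} in EH].

Lemma prod_copy_of (R : numDomainType) (n k : nat) (mu : {set 'I_n} -> R)
    (EH : {set {set 'I_k}}) (f : {ffun 'I_k -> 'I_n}) : injective f ->
  \prod_(e in copy_of n k EH f) mu e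
    = \prod_(e in EH) mu [set f x | x in e].
Proof.
by move=> f_inj; apply: big_imset => e1 e2 _ _; apply: imset_inj.
Qed.

Lemma copiesP (n k : nat) (EH : {set {set 'I_k}}) (S : {set {set 'I_n}}) :
  reflect (exists2 f : {ffun 'I_k -> 'I_n}, injective f & S = copy_of n k EH f)
          (S \in copies n EH).
Proof.
apply: (iffP imsetP) => [[f]|[f f_inj ->]].
  by rewrite inE => /injectiveP f_inj ->; exists f.
by exists f; rewrite ?inE //; apply/injectiveP.
Qed.

Lemma copy_edge (n k : nat) (EH : {set {set 'I_k}}) (S : {set {set 'I_n}}) e :
  (forall e', e' \in EH -> is_edge e') -> S \in copies n EH -> e \in S -> is_edge e.
Proof.
move=> EH_edge /copiesP[f f_inj ->] /imsetP[e' /EH_edge e'2 ->].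
by rewrite /is_edge card_imset.
Qed.

(* Composing an embedding with the automorphisms [s i] yields [#|I|] distinct
   embeddings of each copy. *)
Lemma beta_le_embeddings (R : numDomainType) (n k : nat) (mu : {set 'I_n} -> R)
    (EH : {set {set 'I_k}}) (I : finType) (s : I -> 'I_k -> 'I_k) :
  (forall e, is_edge e -> 0 <= mu e) ->
  (forall e, e \in EH -> is_edge e) ->
  (forall i, injective (s i)) ->
  (forall i e, e \in EH -> [set s i x | x in e] \in EH) ->
  (forall i j, s i =1 s j -> i = j) ->
  #|I|%:R * beta mu EH
    <= \sum_(f : {ffun 'I_k -> 'I_n} | injectiveb f)
         \prod_(e in EH) mu [set f x | x in e].
Proof.
move=> mu_ge0 EH_edge s_inj s_EH s_sep.
rewrite (partition_big (copy_of n k EH) (mem (copies n EH))) /=; last first.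
  by move=> f /injectiveP f_inj; apply/copiesP; exists f.
rewrite /beta mulr_sumr; apply: ler_sum => S S_copy.
have w_ge0 : 0 <= \prod_(e in S) mu e.
  by apply: prodr_ge0 => e eS; exact: mu_ge0 (copy_edge n k EH S e EH_edge S_copy eS).
rewrite [leRHS](eq_bigr (fun=> \prod_(e in S) mu e)); last first.
  by move=> f /andP[/injectiveP f_inj /eqP<-]; rewrite prod_copy_of.
rewrite sumr_const -[leRHS]mulr_natl; apply: ler_wpM2r => //; rewrite ler_nat.
have /copiesP[f f_inj SE] := S_copy.
pose g i : {ffun 'I_k -> 'I_n} := [ffun x => f (s i x)].
have g_inj : injective g.
  move=> i j /ffunP gE; apply: s_sep => x.
  by have := gE x; rewrite !ffunE => /f_inj.
rewrite -(card_imset predT g_inj); apply: subset_leq_card.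
apply/subsetP => _ /imsetP[i _ ->]; rewrite unfold_in; apply/andP; split.
  by apply/injectiveP => x y; rewrite !ffunE => /f_inj /s_inj.
(* Inclusion together with equal cardinality: [s i] permutes the edges. *)
have sE : [set [set s i x | x in e] | e : {set 'I_k} in EH] = EH.
  apply/eqP; rewrite eqEcard card_imset ?leqnn ?andbT; last exact/imset_inj/s_inj.
  by apply/subsetP => _ /imsetP[e eE ->]; apply: s_EH.
rewrite SE /copy_of -[in X in _ == X]sE -imset_comp; apply/eqP/eq_imset => e /=.
by rewrite -imset_comp; apply: eq_imset => x; rewrite ffunE.
Qed.

(** * Sums over maps as iterated sums over vertices *)

Lemma codom_ordSl (T : Type) (k : nat) (f : 'I_k.+1 -> T) :
  codom f = f ord0 :: codom (f \o lift ord0).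
Proof. by rewrite !codomE enum_ordSl /= -map_comp. Qed.

Lemma codom_ord0 (T : Type) (f : 'I_0 -> T) : codom f = [::].
Proof. by rewrite codomE (size0nil (size_enum_ord 0)). Qed.

Lemma last_codom_ord (T : Type) (k : nat) (f : 'I_k.+1 -> T) x :
  last x (codom f) = f ord_max.
Proof.
elim: k f x => [|k IH] f x; rewrite codom_ordSl /=.
  by rewrite codom_ord0 /=; congr f; apply: val_inj.
by rewrite IH /=; congr f; apply: val_inj.
Qed.

(** Writing the summand as a function of the list [codom f] makes this step repeatable, one vertex
    at a time. *)
Lemma sum_codom_ordS (R : nmodType) (T : finType) (k : nat) (G : seq T -> R) :
  \sum_(f : {ffun 'I_k.+1 -> T}) G (codom f)
    = \sum_x \sum_(g : {ffun 'I_k -> T}) G (x :: codom g).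
Proof.
rewrite pair_bigA /= (reindex (fun p : T * {ffun 'I_k -> T} =>
  [ffun i => if unlift ord0 i is Some j then p.2 j else p.1])) /=.
  apply: eq_bigr => -[x g] _ /=; congr G; rewrite codom_ordSl ffunE unlift_none.
  by congr (_ :: _); apply: eq_codom => i; rewrite /= ffunE liftK.
exists (fun f : {ffun 'I_k.+1 -> T} => (f ord0, [ffun i => f (lift ord0 i)])).
  move=> [x g] _ /=; congr (_, _); first by rewrite ffunE unlift_none.
  by apply/ffunP => i; rewrite !ffunE liftK.
move=> f _; apply/ffunP => i; rewrite ffunE /=.
by case: unliftP => [j|] ->; rewrite ?ffunE.
Qed.

Lemma sum_codom_ord0 (R : nmodType) (T : finType) (G : seq T -> R) :
  \sum_(f : {ffun 'I_0 -> T}) G (codom f) = G [::].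
Proof.
rewrite (eq_bigr (fun=> G [::])) => [|f _]; last by rewrite codom_ord0.
by rewrite sumr_const card_ffun card_ord expn0.
Qed.

Fixpoint path_prod (R : pzSemiRingType) (T : Type) (W : T -> T -> R)
    (x : T) (s : seq T) : R :=
  if s is y :: s' then W x y * path_prod R T W y s' else 1.

Lemma path_prodE (R : pzSemiRingType) (T : Type) (W : T -> T -> R) (k : nat)
    (f : 'I_k.+1 -> T) :
  \prod_(i < k) W (f (widen_ord (leqnSn k) i)) (f (lift ord0 i))
    = path_prod R T W (f ord0) (codom (f \o lift ord0)).
Proof.
elim: k f => [|k IH] f; first by rewrite big_ord0 codom_ord0.
rewrite big_ord_recl codom_ordSl /=; congr (W (f _) _ * _).
  exact: val_inj.
rewrite -(IH (f \o lift ord0)); apply: eq_bigr => i _ /=.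
by congr (W (f _) _); apply: val_inj.
Qed.

(** The diagonal is set to 0 because [mu] is unconstrained on the singleton [[set i; i]]. *)
Definition edge_weight (R : nmodType) (n : nat) (mu : {set 'I_n} -> R)
    (i j : 'I_n) : R :=
  if i == j then 0 else mu [set i; j].

Lemma edge_weight_imset (R : nmodType) (n k : nat) (mu : {set 'I_n} -> R)
    (f : 'I_k -> 'I_n) x y : injective f -> x != y ->
  mu [set f z | z in [set x; y]] = edge_weight R n mu (f x) (f y).
Proof.
move=> f_inj xy.
by rewrite imsetU1 imset_set1 /edge_weight (inj_eq f_inj) (negbTE xy).
Qed.

(** * From an edge measure to a weighted graph *)

Section EdgeWeight.
Variables (R : realFieldType) (n : nat) (mu : {set 'I_n} -> R).
Hypothesis mu_prob : edge_prob_measure mu.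
Local Notation W := (edge_weight R n mu).

Lemma edge_weight_sym i j : W i j = W j i.
Proof. by rewrite /edge_weight eq_sym setUC. Qed.

Lemma edge_weight_diag i : W i i = 0.
Proof. by rewrite /edge_weight eqxx. Qed.

Lemma edge_weight_ge0 i j : 0 <= W i j.
Proof.
rewrite /edge_weight; case: eqVneq => // ij.
by apply: mu_prob.1; rewrite /is_edge cards2 ij.
Qed.

(** Every edge arises from exactly two ordered pairs, so the total mass 1 is doubled. *)
Lemma edge_weight_total : \sum_i \sum_j W i j = 2.
Proof.
rewrite pair_bigA /= (bigID (fun p => p.1 == p.2)) /= big1 ?add0r; last first.
  by move=> p /eqP->; rewrite edge_weight_diag.
rewrite (partition_big (fun p => [set p.1; p.2]) (@is_edge n)) /=; last first.
  by move=> p p12; rewrite /is_edge cards2 p12.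
rewrite -[RHS]mulr1 -[X in _ = _ * X]mu_prob.2 mulr_sumr; apply: eq_bigr => e.
move=> /cards2P[x [y [xy ->]]].
rewrite (eq_bigr (fun=> mu [set x; y])); last first.
  by move=> p /andP[p12 /eqP<-]; rewrite /edge_weight (negbTE p12).
rewrite sumr_const mulr_natl; congr (_ *+ _).
have -> : 2%N = #|[set (x, y); (y, x)]|.
  by rewrite cards2 xpair_eqE (negbTE xy).
apply: eq_card => -[a b]; rewrite !inE unfold_in /= !xpair_eqE.
apply/andP/orP => [[ab /eqP E]|[/andP[/eqP-> /eqP->]|/andP[/eqP-> /eqP->]]].
- have : a \in [set x; y] by rewrite -E set21.
  have : b \in [set x; y] by rewrite -E set22.
  move: ab; rewrite !inE => ab /orP[] /eqP bE /orP[] /eqP aE; move: ab;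
    rewrite aE bE !eqxx //=; by [left|right].
- by rewrite xy.
- by rewrite eq_sym xy setUC.
Qed.

Lemma prod_edges_ge0 (k : nat) (EH : {set {set 'I_k}}) (S : {set {set 'I_n}}) :
  (forall e, e \in EH -> is_edge e) -> S \in copies n EH ->
  0 <= \prod_(e in S) mu e.
Proof.
move=> EH_edge S_copy.
by apply: prodr_ge0 => e eS; exact: mu_prob.1 (copy_edge n k EH S e EH_edge S_copy eS).
Qed.

Lemma beta_ge0 (k : nat) (EH : {set {set 'I_k}}) :
  (forall e, e \in EH -> is_edge e) -> 0 <= beta mu EH.
Proof. by move=> EH_edge; apply: sumr_ge0 => S; apply: prod_edges_ge0. Qed.

End EdgeWeight.

(** * Edges and reversal of a path *)

Definition path_edge (k : nat) (i : 'I_k) : {set 'I_k.+1} :=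
  [set widen_ord (leqnSn k) i; lift ord0 i].

Lemma path_graphE (k : nat) : path_graph k.+1 = [set path_edge k i | i : 'I_k].
Proof.
apply/setP => e; rewrite inE; apply/existsP/imsetP => [[i /existsP[j]]|[i _ ->]].
  move=> /andP[/eqP-> /eqP ij].
  have ik : (i < k)%N by have := ltn_ord j; rewrite ij.
  exists (Ordinal ik) => //; congr [set _; _]; exact: val_inj.
exists (widen_ord (leqnSn k) i); apply/existsP; exists (lift ord0 i).
by rewrite /path_edge !eqxx.
Qed.

Lemma path_edge_neq (k : nat) (i : 'I_k) : widen_ord (leqnSn k) i != lift ord0 i.
Proof. by rewrite -val_eqE /= /bump /= add1n neq_ltn ltnSn. Qed.

Lemma path_edge_inj (k : nat) : injective (path_edge k).
Proof.
move=> i j ij.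
have := set21 (widen_ord (leqnSn k) i) (lift ord0 i).
have := set22 (widen_ord (leqnSn k) i) (lift ord0 i).
rewrite -/(path_edge k i) ij !inE -!val_eqE /= /bump /= !add1n => h1 h2.
by apply: val_inj => /=; lia.
Qed.

Lemma path_graph_edge (k : nat) e : e \in path_graph k.+1 -> is_edge e.
Proof.
by rewrite path_graphE => /imsetP[i _ ->]; rewrite /is_edge cards2 path_edge_neq.
Qed.

(** The factor 2 comes from the identity and the reversal [rev_ord], which differ at [ord0] because
    there are at least two vertices. *)
Lemma beta_path_le (R : realFieldType) (n k : nat) (mu : {set 'I_n} -> R) :
  edge_prob_measure mu ->
  2 * beta mu (path_graph k.+2)
   <= \sum_(f : {ffun 'I_k.+2 -> 'I_n} | injectiveb f)
        path_prod R 'I_n (edge_weight R n mu) (f ord0) (codom (f \o lift ord0)).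
Proof.
move=> [mu_ge0 _].
pose s (b : bool) := if b then @rev_ord k.+2 else id.
have := beta_le_embeddings R n k.+2 mu (path_graph k.+2) bool s mu_ge0
  (path_graph_edge k.+1).
rewrite card_bool => /(_ _ _ _)/le_trans; apply.
- by case; [exact: rev_ord_inj|exact: inj_id].
- case=> e; rewrite path_graphE => /imsetP[i _ ->]; last first.
    by rewrite imset_id; apply: imset_f.
  rewrite /path_edge imsetU1 imset_set1 setUC; apply/imsetP.
  exists (rev_ord i) => //; congr [set _; _]; apply: val_inj => /=;
    rewrite /bump /= !add1n; have := ltn_ord i; lia.
- by case; case=> // /(_ ord0) /(congr1 val).
apply: ler_sum => f /injectiveP f_inj.
rewrite path_graphE big_imset => [|i j _ _]; last exact: path_edge_inj.
rewrite -path_prodE le_eqVlt; apply/orP; left; apply/eqP/eq_bigr => i _.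
by rewrite edge_weight_imset // path_edge_neq.
Qed.

(** * Edges and dihedral symmetries of a cycle *)

Definition cycle_edge (p : nat) (i : 'I_p.+3) : {set 'I_p.+3} := [set i; i + 1].

(** Addition in ['I_p.+3] is modular, so [i + 1] is the cyclic successor of [cycle_graph]. *)
Lemma val_add1 (p : nat) (i : 'I_p.+3) : val (i + 1) = ((val i).+1 %% p.+3)%N.
Proof. by rewrite /= modnDmr addn1. Qed.

Lemma cycle_graphE (p : nat) :
  cycle_graph p.+3 = [set cycle_edge p i | i : 'I_p.+3].
Proof.
apply/setP => e; rewrite inE; apply/existsP/imsetP => [[i /existsP[j]]|[i _ ->]].
  move=> /andP[/eqP-> /eqP ij]; exists i => //; congr [set _; _].
  by apply: val_inj; rewrite val_add1.
by exists i; apply/existsP; exists (i + 1); rewrite val_add1 !eqxx.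
Qed.

Lemma cycle_edge_neq (p : nat) (i : 'I_p.+3) : i != i + 1.
Proof. by rewrite -[i in X in X != _]addr0 (inj_eq (addrI i)). Qed.

Lemma ord_two_neq0 (p : nat) : (1 + 1 : 'I_p.+3) != 0.
Proof. by []. Qed.

(** If [i = j + 1], then [j + 2] would have to be [j] or [j + 1], impossible with at least three
    vertices. *)
Lemma cycle_edge_inj (p : nat) : injective (cycle_edge p).
Proof.
move=> i j ij; have := set21 i (i + 1); have := set22 i (i + 1).
rewrite -/(cycle_edge p i) ij !inE => h1 /orP[/eqP //|/eqP iE].
move: h1; rewrite iE -addrA (inj_eq (addrI j)) -[X in _ == X]addr0.
by rewrite (inj_eq (addrI j)).
Qed.

Lemma cycle_graph_edge (p : nat) e : e \in cycle_graph p.+3 -> is_edge e.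
Proof.
by rewrite cycle_graphE => /imsetP[i _ ->]; rewrite /is_edge cards2 cycle_edge_neq.
Qed.

(** The [2 * p.+3] automorphisms are the rotations [c + x] and the reflections [c - x]. *)
Lemma beta_cycle_le (R : realFieldType) (n p : nat) (mu : {set 'I_n} -> R) :
  edge_prob_measure mu ->
  (2 * p.+3)%:R * beta mu (cycle_graph p.+3)
   <= \sum_(f : {ffun 'I_p.+3 -> 'I_n} | injectiveb f)
        path_prod R 'I_n (edge_weight R n mu) (f ord0) (codom (f \o lift ord0))
        * edge_weight R n mu (f ord_max) (f ord0).
Proof.
move=> [mu_ge0 _].
pose s (c : bool * 'I_p.+3) (x : 'I_p.+3) := if c.1 then c.2 + x else c.2 - x.
have := beta_le_embeddings R n p.+3 mu (cycle_graph p.+3)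
  (bool * 'I_p.+3)%type s mu_ge0 (cycle_graph_edge p).
rewrite card_prod card_bool card_ord => /(_ _ _ _)/le_trans; apply.
- by case=> [] [] c; [exact: addrI|move=> x y /addrI /oppr_inj].
- move=> c e; rewrite cycle_graphE => /imsetP[i _ ->].
  rewrite /cycle_edge imsetU1 imset_set1 /s; case: c.1; apply/imsetP.
    by exists (c.2 + i); rewrite // addrA.
  exists (c.2 - (i + 1)) => //.
  by rewrite setUC /cycle_edge opprD addrA subrK.
- move=> [b c] [b' c'] sE; have := sE 0; have := sE 1; rewrite /s /=.
  (* A rotation and a reflection agreeing at 0 and at 1 would force [1 = -1]. *)
  have two0 := ord_two_neq0 p.
  case: b {sE}; case: b'; rewrite ?addr0 ?subr0 => h1 h2; rewrite ?h2 //.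
    move: h1; rewrite h2 => /addrI /eqP.
    by rewrite -subr_eq0 opprK (negbTE two0).
  move: h1; rewrite h2 => /addrI /eqP.
  by rewrite eq_sym -subr_eq0 opprK (negbTE two0).
apply: ler_sum => f /injectiveP f_inj.
rewrite cycle_graphE big_imset => [|i j _ _]; last exact: cycle_edge_inj.
rewrite -path_prodE le_eqVlt; apply/orP; left; apply/eqP.
(* The last factor is the closing edge, since [ord_max + 1] wraps around to 0. *)
rewrite big_ord_recr /=; congr (_ * _); last first.
  rewrite edge_weight_imset ?cycle_edge_neq //; congr (edge_weight _ _ _ _ (f _)).
  by apply: val_inj; rewrite val_add1 /= modnn.
apply: eq_bigr => i _; rewrite edge_weight_imset ?cycle_edge_neq //.
congr (edge_weight _ _ _ _ (f _)); apply: val_inj; rewrite val_add1 /=.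
by rewrite modn_small // ltnS ltn_ord.
Qed.

Lemma sum_embeddings (R : pzSemiRingType) (T : finType) (k : nat) (G : seq T -> R)
    (H : {ffun 'I_k -> T} -> R) :
  (forall f : {ffun 'I_k -> T}, injective f -> H f = G (codom f)) ->
  \sum_(f : {ffun 'I_k -> T} | injectiveb f) H f
    = \sum_(f : {ffun 'I_k -> T}) (uniq (codom f))%:R * G (codom f).
Proof.
move=> HG; rewrite big_mkcond; apply: eq_bigr => f _.
rewrite -[uniq (codom f)]/(injectiveb f).
by case: injectiveP => [/HG->|_]; rewrite ?mul1r ?mul0r.
Qed.

Definition seq_path_prod (R : pzSemiRingType) (T : Type) (W : T -> T -> R)
    (s : seq T) : R :=
  if s is x :: s' then path_prod R T W x s' else 0.

Definition seq_cycle_prod (R : pzSemiRingType) (T : Type) (W : T -> T -> R)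
    (s : seq T) : R :=
  if s is x :: s' then path_prod R T W x s' * W (last x s') x else 0.

(** * Bounds on [beta] by labelled sums, and uniform measures on cycles *)

Section BetaBounds.
Variables (R : realFieldType) (n : nat) (mu : {set 'I_n} -> R).
Hypothesis mu_prob : edge_prob_measure mu.
Local Notation W := (edge_weight R n mu).
Local Notation W_ge0 := (edge_weight_ge0 R n mu mu_prob).
Local Notation sum_first G := (sum_codom_ordS R 'I_n _ G).

Lemma beta_path_codom k : 2 * beta mu (path_graph k.+2)
  <= \sum_(f : {ffun 'I_k.+2 -> 'I_n})
       (uniq (codom f))%:R * seq_path_prod R 'I_n W (codom f).
Proof.
apply: le_trans (beta_path_le R n k mu mu_prob) _.
rewrite (sum_embeddings _ _ _ (seq_path_prod R 'I_n W)) // => f _.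
by rewrite [X in seq_path_prod _ _ _ X]codom_ordSl.
Qed.

Lemma beta_cycle_codom p : (2 * p.+3)%:R * beta mu (cycle_graph p.+3)
  <= \sum_(f : {ffun 'I_p.+3 -> 'I_n})
       (uniq (codom f))%:R * seq_cycle_prod R 'I_n W (codom f).
Proof.
apply: le_trans (beta_cycle_le R n p mu mu_prob) _.
rewrite (sum_embeddings _ _ _ (seq_cycle_prod R 'I_n W)) // => f _.
by rewrite -(last_codom_ord _ _ f (f ord0)) (codom_ordSl _ _ f).
Qed.

Lemma beta_path4_le : 2 * beta mu (path_graph 4) <= path4_weight R 'I_n W.
Proof.
apply: le_trans (beta_path_codom _) _.
pose G s := (uniq s)%:R * seq_path_prod R 'I_n W s.
rewrite (sum_first G); apply: ler_sum => a _.
rewrite (sum_first (fun s => G (a :: s))); apply: ler_sum => v _.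
rewrite (sum_first (fun s => G [:: a, v & s])); apply: ler_sum => b _.
rewrite (sum_first (fun s => G [:: a, v, b & s])); apply: ler_sum => t _.
rewrite (sum_codom_ord0 _ _ (fun s => G [:: a, v, b, t & s])).
by rewrite /G /seq_path_prod [path_prod _ _ _ _ _]/= mulr1 !mulrA.
Qed.

Lemma beta_path5_le : 2 * beta mu (path_graph 5) <= path5_weight R 'I_n W.
Proof.
apply: le_trans (beta_path_codom _) _.
pose G s := (uniq s)%:R * seq_path_prod R 'I_n W s.
rewrite (sum_first G); apply: ler_sum => a _.
rewrite (sum_first (fun s => G (a :: s))); apply: ler_sum => v _.
rewrite (sum_first (fun s => G [:: a, v & s])); apply: ler_sum => b _.
rewrite (sum_first (fun s => G [:: a, v, b & s])); apply: ler_sum => t _.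
rewrite (sum_first (fun s => G [:: a, v, b, t & s])); apply: ler_sum => u _.
rewrite (sum_codom_ord0 _ _ (fun s => G [:: a, v, b, t, u & s])).
by rewrite /G /seq_path_prod [path_prod _ _ _ _ _]/= mulr1 !mulrA.
Qed.

Lemma beta_cycle3_le : 6 * beta mu (cycle_graph 3) <= cycle3_weight R 'I_n W.
Proof.
apply: le_trans (beta_cycle_codom 0) _.
pose G s := (uniq s)%:R * seq_cycle_prod R 'I_n W s.
rewrite (sum_first G); apply: ler_sum => a _.
rewrite (sum_first (fun s => G (a :: s))); apply: ler_sum => v _.
rewrite (sum_first (fun s => G [:: a, v & s])); apply: ler_sum => b _.
rewrite (sum_codom_ord0 _ _ (fun s => G [:: a, v, b & s])).
rewrite /G /seq_cycle_prod [path_prod _ _ _ _ _]/= [last _ _]/= mulr1.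
(* [cycle3_weight] carries no [uniq] factor; nonnegativity allows dropping it. *)
have h : 0 <= W a v * W v b * W b a.
  by apply: mulr_ge0; [apply: mulr_ge0|]; exact: W_ge0.
by case: (uniq _); rewrite ?mul1r ?mul0r.
Qed.

Lemma beta_cycle4_le : 8 * beta mu (cycle_graph 4) <= cycle4_weight R 'I_n W.
Proof.
apply: le_trans (beta_cycle_codom 1) _.
pose G s := (uniq s)%:R * seq_cycle_prod R 'I_n W s.
rewrite (sum_first G); apply: ler_sum => a _.
rewrite (sum_first (fun s => G (a :: s))); apply: ler_sum => v _.
rewrite (sum_first (fun s => G [:: a, v & s])); apply: ler_sum => b _.
rewrite (sum_first (fun s => G [:: a, v, b & s])); apply: ler_sum => t _.
rewrite (sum_codom_ord0 _ _ (fun s => G [:: a, v, b, t & s])).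
by rewrite /G /seq_cycle_prod [path_prod _ _ _ _ _]/= [last _ _]/= mulr1 !mulrA.
Qed.

Lemma card_cycle_copy p (S : {set {set 'I_n}}) :
  S \in copies n (cycle_graph p.+3) -> #|S| = p.+3.
Proof.
move=> /copiesP[f f_inj ->]; rewrite card_imset; last exact: imset_inj.
rewrite cycle_graphE card_imset ?card_ord //; exact: cycle_edge_inj.
Qed.

(** The [p.+3] edges of the cycle already carry total mass 1, so every other edge gets 0. *)
Lemma uniform_on_cycle p (f : {ffun 'I_p.+3 -> 'I_n}) : injective f ->
  (forall i, W (f i) (f (i + 1)) = 1 / p.+3%:R) ->
  exists2 S, S \in copies n (cycle_graph p.+3) &
    forall e : {set 'I_n}, is_edge e -> mu e = (if e \in S then 1 / p.+3%:R else 0).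
Proof.
move=> f_inj Wf; pose S := copy_of n _ (cycle_graph p.+3) f.
have S_copy : S \in copies n (cycle_graph p.+3) by apply/copiesP; exists f.
have S_edge e := copy_edge n _ _ S e (cycle_graph_edge p) S_copy.
have mu_S e : e \in S -> mu e = 1 / p.+3%:R.
  move=> /imsetP[e']; rewrite cycle_graphE => /imsetP[i _ ->] ->.
  by rewrite (edge_weight_imset R) ?cycle_edge_neq ?Wf.
have sum_S : \sum_(e | is_edge e && (e \in S)) mu e = 1.
  rewrite (eq_bigl (mem S)) => [|e]; last first.
    by rewrite andbC; case eS: (e \in S); rewrite //= S_edge.
  rewrite (eq_bigr _ mu_S) sumr_const (card_cycle_copy p) // -[LHS]mulr_natr.
  by rewrite div1r mulVf // pnatr_eq0.
have := mu_prob.2; rewrite (bigID (mem S)) /= sum_S => /eqP.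
rewrite -[X in _ == X]addr0 (inj_eq (addrI 1)) => /eqP sum_nS.
exists S => // e e2; case: ifP => [/mu_S //|/negbT eS].
have h e' : is_edge e' && (e' \notin S) -> 0 <= mu e'.
  by move=> /andP[/mu_prob.1].
by apply: (psumr_eq0P h sum_nS); rewrite e2.
Qed.

(** Keeps only the term of [S]. With [m = p.+3], multiplying by [2 * m] already reaches
    [2 / m ^ (m - 1)]. *)
Lemma beta_cycle_uniform_ge p (S : {set {set 'I_n}}) :
  S \in copies n (cycle_graph p.+3) ->
  (forall e : {set 'I_n}, is_edge e -> mu e = (if e \in S then 1 / p.+3%:R else 0)) ->
  (1 / p.+3%:R) ^+ p.+3 <= beta mu (cycle_graph p.+3).
Proof.
move=> S_copy mu_S; rewrite /beta (bigD1 S) //=.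
rewrite (eq_bigr (fun=> 1 / p.+3%:R)) => [|e eS]; last first.
  by rewrite mu_S ?eS // (copy_edge n _ _ S e (cycle_graph_edge p)).
rewrite prodr_const (card_cycle_copy p) // lerDl.
apply: sumr_ge0 => S' /andP[S'_copy _].
exact: (prod_edges_ge0 R n mu mu_prob _ _ _ (cycle_graph_edge p)).
Qed.

End BetaBounds.

Theorem theorem4p6 (R : realFieldType) (m n : nat) (mu : {set 'I_n} -> R) :
  (m = 3%N \/ m = 4%N) -> edge_prob_measure mu ->
  (2 * m)%:R * beta mu (cycle_graph m) + beta mu (path_graph m.+1)
    <= 2 / (m ^ (m - 1))%:R
  /\ ((2 * m)%:R * beta mu (cycle_graph m) + beta mu (path_graph m.+1)
        = 2 / (m ^ (m - 1))%:R
      <-> exists2 S, S \in copies n (cycle_graph m) &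
            forall e : {set 'I_n}, is_edge e ->
              mu e = (if e \in S then 1 / m%:R else 0)).
Proof.
move=> m34 mu_prob.
have W_sym := edge_weight_sym R n mu.
have W_diag := edge_weight_diag R n mu.
have W_ge0 := edge_weight_ge0 R n mu mu_prob.
have W_tot := edge_weight_total R n mu mu_prob.
have P_ge0 k := beta_ge0 R n mu mu_prob _ _ (path_graph_edge k).
case: m34 => ->.
  have hC := beta_cycle3_le R n mu mu_prob.
  have hP := beta_path4_le R n mu mu_prob.
  have hB := cycle3_path4_le R _ _ W_sym W_diag W_ge0 W_tot.
  have -> : 2 / (3 ^ (3 - 1))%:R = 2 / 9 :> R by [].
  have -> : (2 * 3)%:R = 6 :> R by [].
  (* Half of [hB]; equality here therefore forces equality in [hB], which is how [F_eq] is used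
     below. *)
  have le_F : 6 * beta mu (cycle_graph 3) + beta mu (path_graph 4) <= 2 / 9 by lra.
  split=> //; split=> [F_eq|[S S_copy mu_S]].
    have [|x [y [z [u3 xy yz zx]]]] :=
      cycle3_path4_eq R _ _ W_sym W_diag W_ge0 W_tot.
      lra.
    pose f : {ffun 'I_3 -> 'I_n} := [ffun i : 'I_3 => nth x [:: x; y; z] i].
    apply: (uniform_on_cycle R n mu mu_prob 0 f).
      move=> i j; rewrite !ffunE => /eqP.
      by rewrite nth_uniq // => /eqP/val_inj.
    by move=> i; rewrite !ffunE; case: i => [[|[|[|]]]].
  (* The cycle term alone attains the bound and the path term is nonnegative, so [le_F] gives
     equality. *)
  have := beta_cycle_uniform_ge R n mu mu_prob 0 S S_copy mu_S.
  have := P_ge0 3%N; lra.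
have hC := beta_cycle4_le R n mu mu_prob.
have hP := beta_path5_le R n mu mu_prob.
have hB := cycle4_path5_le R _ _ W_sym W_diag W_ge0 W_tot.
have -> : 2 / (4 ^ (4 - 1))%:R = 2 / 64 :> R by [].
have -> : (2 * 4)%:R = 8 :> R by [].
have le_F : 8 * beta mu (cycle_graph 4) + beta mu (path_graph 5) <= 2 / 64 by lra.
split=> //; split=> [F_eq|[S S_copy mu_S]].
  have [|a [v [b [t [u4 av vb bt ta]]]]] :=
    cycle4_path5_eq R _ _ W_sym W_diag W_ge0 W_tot.
    lra.
  pose f : {ffun 'I_4 -> 'I_n} := [ffun i : 'I_4 => nth a [:: a; v; b; t] i].
  apply: (uniform_on_cycle R n mu mu_prob 1 f).
    move=> i j; rewrite !ffunE => /eqP.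
    by rewrite nth_uniq // => /eqP/val_inj.
  by move=> i; rewrite !ffunE; case: i => [[|[|[|[|]]]]].
have := beta_cycle_uniform_ge R n mu mu_prob 1 S S_copy mu_S.
have := P_ge0 4%N; lra.
Qed.
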